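(* Suppose that every language satisfying the partial order condition belongs to $\mathbf{RMM}$. Then $\mathbf{RMM}$ is closed under intersection.
   Context: A DFA $(Q,\Sigma,\delta,q_0,F)$ satisfies the partial order condition if there do not exist two distinguishable states $q_1,q_2$ and strings $x,y\in\Sigma^+$ with $\delta(q_1,x)=\delta(q_2,x)=q_2$ and $\delta(q_2,y)=q_1$ (states are distinguishable if some $z\in\Sigma^*$ leads exactly one of them into $F$); a regular language satisfies it if its minimal DFA does. A measure-many quantum finite automaton (MM-QFA) over $\Sigma$ is a tuple $(Q,\Sigma,\{U_\sigma\}_{\sigma\in\Sigma\cup\{\$\}},q_0,Q_{acc},Q_{rej})$ with $Q$ finite indexing an orthonormal basis of $\mathbb{C}^Q$, end-marker $\$\notin\Sigma$, unitary $U_\sigma$, initial state $q_0$, and $Q$ partitioned into $Q_{acc},Q_{rej},Q_{non}$ with projections $P_{acc},P_{rej},P_{non}$ onto the corresponding spans. On input $x$ it processes $x\$$ maintaining $(\psi,p_{acc},p_{rej})$, initially $(|q_0\rangle,0,0)$; on reading $\sigma$: $\psi'=U_\sigma\psi$, $p_{acc}\mathrel{+}=\|P_{acc}\psi'\|^2$, $p_{rej}\mathrel{+}=\|P_{rej}\psi'\|^2$, $\psi\leftarrow P_{non}\psi'$; the acceptance probability is the final $p_{acc}$. $\mathbf{RMM}$ is the class of languages $L$ for which some MM-QFA and some $\lambda$, $\epsilon>0$ give acceptance probability $>\lambda+\epsilon$ on $x\in L$ and $<\lambda-\epsilon$ on $x\notin L$. *)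

(* Defs.v *)
From HB Require Import structures.
From mathcomp Require Import all_boot all_order all_algebra complex.
From mathcomp Require Import Rstruct.

Set Implicit Arguments.
Unset Strict Implicit.
Unset Printing Implicit Defensive.

Import Order.TTheory GRing.Theory Num.Theory.
Local Open Scope ring_scope.

Notation Real := Rdefinitions.R.
Notation Cplx := (Real[i]).

Definition language (Sigma : finType) := seq Sigma -> Prop.

Record dfa (Sigma : finType) := DFA {
  dstate : finType;
  ddelta : dstate -> Sigma -> dstate;
  dstart : dstate;
  dfinal : pred dstate }.

Definition dstar (Sigma : finType) (A : dfa Sigma) (q : dstate A) (w : seq Sigma)
  : dstate A := foldl (@ddelta _ A) q w.

Definition dfa_lang (Sigma : finType) (A : dfa Sigma) : language Sigma :=
  fun w => @dfinal _ A (dstar (@dstart _ A) w).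

Definition recognizes (Sigma : finType) (A : dfa Sigma) (L : language Sigma) :=
  forall w, L w <-> dfa_lang A w.

Definition minimal_dfa_of (Sigma : finType) (A : dfa Sigma) (L : language Sigma) :=
  recognizes A L /\
  forall A' : dfa Sigma, recognizes A' L -> (#|dstate A| <= #|dstate A'|)%N.

Definition distinguishable (Sigma : finType) (A : dfa Sigma) (q1 q2 : dstate A) :=
  exists z : seq Sigma, @dfinal _ A (dstar q1 z) != @dfinal _ A (dstar q2 z).

Definition dfa_poc (Sigma : finType) (A : dfa Sigma) :=
  ~ exists (q1 q2 : dstate A) (x y : seq Sigma),
      [/\ distinguishable q1 q2, x != [::] & y != [::]] /\
      [/\ dstar q1 x = q2, dstar q2 x = q2 & dstar q2 y = q1].

(* a (regular) language satisfies the partial order condition if its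
   minimal DFA does (the minimal DFA is unique up to isomorphism) *)
Definition lang_poc (Sigma : finType) (L : language Sigma) :=
  exists A : dfa Sigma, minimal_dfa_of A L /\ dfa_poc A.

(* basis states are 'I_n; the input symbols are option Sigma, None being the
   end-marker $. *)
Definition conjT (n : nat) (M : 'M[Cplx]_n) : 'M[Cplx]_n := (map_mx conjc M)^T.

Definition unitary (n : nat) (M : 'M[Cplx]_n) :=
  conjT M *m M = 1%:M /\ M *m conjT M = 1%:M.

Record mmqfa (Sigma : finType) := MMQFA {
  qdim : nat;
  qU : option Sigma -> 'M[Cplx]_qdim;
  qU_unitary : forall s, unitary (qU s);
  qstart : 'I_qdim;
  qacc : {set 'I_qdim};
  qrej : {set 'I_qdim};
  qacc_rej_disjoint : [disjoint qacc & qrej] }.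

Definition qnon (Sigma : finType) (M : mmqfa Sigma) : {set 'I_(qdim M)} :=
  ~: (qacc M :|: qrej M).

Definition proj (n : nat) (S : {set 'I_n}) (psi : 'cV[Cplx]_n) : 'cV[Cplx]_n :=
  \col_i (if i \in S then psi i 0 else 0).

Definition sqmod (z : Cplx) : Real := complex.Re z ^+ 2 + complex.Im z ^+ 2.

Definition normsq (n : nat) (psi : 'cV[Cplx]_n) : Real := \sum_i sqmod (psi i 0).

Definition qstep (Sigma : finType) (M : mmqfa Sigma)
    (c : 'cV[Cplx]_(qdim M) * Real * Real) (s : option Sigma) :=
  let: (psi, pa, pr) := c in
  let psi' := qU M s *m psi in
  (proj (qnon M) psi', pa + normsq (proj (qacc M) psi'),
   pr + normsq (proj (qrej M) psi')).

Definition acc_prob (Sigma : finType) (M : mmqfa Sigma) (x : seq Sigma) : Real :=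
  (foldl (@qstep Sigma M) (delta_mx (qstart M) 0, 0, 0)
     (map Some x ++ [:: None])).1.2.

Definition RMM (Sigma : finType) (L : language Sigma) :=
  exists (M : mmqfa Sigma) (lambda eps : Real), 0 < eps /\
    forall x : seq Sigma,
      (L x -> lambda + eps < acc_prob M x) /\
      (~ L x -> acc_prob M x < lambda - eps).

(* Main.v *)
(** An MM-QFA only loses norm, so among the words leading to a state [q1] one can
    pick [w] whose surviving norm is within [delta] of the infimum.  In a forbidden
    configuration [q1 -x-> q2 -x-> q2 -y-> q1] every [w x^i] can be brought back to
    [q1], hence reading powers of [x] after [w] loses at most [delta]: it acts almost
    isometrically.  By pigeonhole [w x^j] and [w x^(j+k)] are close for some [k > 0],
    and almost-isometry pulls this back to closeness of [w] and [w x^k].  So these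
    two words are equivalent, although they reach [q1] and [q2].  Surviving norms of
    two automata can be added, so the argument applies directly to an intersection,
    which therefore satisfies the partial order condition. *)

From mathcomp Require Import all_boot all_order all_algebra complex Rstruct boolp.
From mathcomp Require Import reals ring lra.
Require Import Defs.

Set Implicit Arguments.
Unset Strict Implicit.
Unset Printing Implicit Defensive.

Import Order.TTheory GRing.Theory Num.Theory.
Local Open Scope ring_scope.

(** * Squared norms *)

Lemma sqmod_ge0 (z : Cplx) : 0 <= sqmod z.
Proof. by rewrite addr_ge0 ?sqr_ge0. Qed.

Lemma sqmod0 : sqmod 0 = 0.
Proof. by rewrite /sqmod /= expr0n addr0. Qed.

Lemma sqmodN (z : Cplx) : sqmod (- z) = sqmod z.
Proof. by case: z => a b; rewrite /sqmod /= !sqrrN. Qed.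

(* Peter-Paul: [2 a b <= t a^2 + b^2 / t]. *)
Lemma sqrD_le (t a b : Real) : 0 < t ->
  (a + b) ^+ 2 <= (1 + t) * a ^+ 2 + (1 + t^-1) * b ^+ 2.
Proof.
move=> t0; rewrite -subr_ge0.
have -> : (1 + t) * a ^+ 2 + (1 + t^-1) * b ^+ 2 - (a + b) ^+ 2
  = t^-1 * (t * a - b) ^+ 2 by field; rewrite gt_eqF.
by rewrite mulr_ge0 ?sqr_ge0 // invr_ge0 ltW.
Qed.

Lemma sqmodD_le (t : Real) (z1 z2 : Cplx) : 0 < t ->
  sqmod (z1 + z2) <= (1 + t) * sqmod z1 + (1 + t^-1) * sqmod z2.
Proof.
case: z1 z2 => [a b] [c d] t0; rewrite /sqmod /=.
by have := sqrD_le a c t0; have := sqrD_le b d t0; lra.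
Qed.

Lemma normsq_ge0 n (psi : 'cV[Cplx]_n) : 0 <= normsq psi.
Proof. by apply: sumr_ge0 => i _; apply: sqmod_ge0. Qed.

Lemma normsqN n (psi : 'cV[Cplx]_n) : normsq (- psi) = normsq psi.
Proof. by apply: eq_bigr => i _; rewrite mxE sqmodN. Qed.

Lemma normsqD_le n (t : Real) (a b : 'cV[Cplx]_n) : 0 < t ->
  normsq (a + b) <= (1 + t) * normsq a + (1 + t^-1) * normsq b.
Proof.
move=> t0; rewrite /normsq !mulr_sumr -big_split /=.
by apply: ler_sum => i _; rewrite mxE sqmodD_le.
Qed.

Lemma sqmod_le_normsq n (psi : 'cV[Cplx]_n) i : sqmod (psi i 0) <= normsq psi.
Proof.
rewrite /normsq (bigD1 i) //= lerDl.
by apply: sumr_ge0 => j _; apply: sqmod_ge0.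
Qed.

Lemma normsq_delta n (i : 'I_n) : normsq (delta_mx i 0) = 1.
Proof.
rewrite /normsq (bigD1 i) //= big1 => [|j ji].
  by rewrite mxE !eqxx /sqmod /= expr1n expr0n /= !addr0.
by rewrite mxE (negPf ji) /= sqmod0.
Qed.

(** The Hermitian form lets [conjT U *m U = 1] cancel in the middle, which gives invariance under
    unitaries. *)
Lemma normsqE n (psi : 'cV[Cplx]_n) :
  ((map_mx conjc psi)^T *m psi) 0 0 = ((normsq psi)%:C)%C.
Proof.
rewrite mxE /normsq rmorph_sum /=; apply: eq_bigr => i _.
rewrite !mxE; case: (psi i 0) => a b; rewrite /sqmod /=.
by apply/eqP; rewrite eq_complex /=; apply/andP; split; apply/eqP; ring.
Qed.

Lemma normsq_unitary n (U : 'M[Cplx]_n) (psi : 'cV[Cplx]_n) :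
  unitary U -> normsq (U *m psi) = normsq psi.
Proof.
move=> [UU _]; apply: (@complexI Real).
rewrite -!normsqE map_mxM trmx_mul mulmxA -(mulmxA _ _ U) -/(conjT U) UU.
by rewrite mulmx1.
Qed.

Lemma projD n (S : {set 'I_n}) (a b : 'cV[Cplx]_n) :
  proj S (a + b) = proj S a + proj S b.
Proof. by apply/colP => i; rewrite !mxE; case: ifP; rewrite ?addr0. Qed.

Lemma projN n (S : {set 'I_n}) (a : 'cV[Cplx]_n) : proj S (- a) = - proj S a.
Proof. by apply/colP => i; rewrite !mxE; case: ifP; rewrite ?oppr0. Qed.

Lemma normsq_projC n (S : {set 'I_n}) (psi : 'cV[Cplx]_n) :
  normsq (proj (~: S) psi) + normsq (proj S psi) = normsq psi.
Proof.
rewrite /normsq -big_split /=; apply: eq_bigr => i _.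
by rewrite !mxE inE; case: (i \in S); rewrite /= sqmod0 ?addr0 ?add0r.
Qed.

Lemma normsq_proj_sub n (S T : {set 'I_n}) (psi : 'cV[Cplx]_n) :
  S \subset T -> normsq (proj S psi) <= normsq (proj T psi).
Proof.
move=> /subsetP ST; apply: ler_sum => i _; rewrite !mxE.
case: ifP => [/ST -> //|_]; rewrite sqmod0.
exact: sqmod_ge0.
Qed.

(** * Runs of a measure-many automaton *)

Definition qmove (Sigma : finType) (M : mmqfa Sigma) psi (s : option Sigma) :=
  proj (qnon M) (qU M s *m psi).
Arguments qmove {Sigma} M psi s.

Definition qrun (Sigma : finType) (M : mmqfa Sigma) psi (w : seq (option Sigma)) :=
  foldl (qmove M) psi w.
Arguments qrun {Sigma} M psi w.

(** The probability absorbed in [S] along a run. Taking [qacc] gives acceptance, taking [qhalt]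
    gives the total norm lost; psi need not have norm 1, so differences of states are allowed. *)
Fixpoint qweight (Sigma : finType) (M : mmqfa Sigma) (S : {set 'I_(qdim M)})
    psi (w : seq (option Sigma)) : Real :=
  if w is s :: w' then
    normsq (proj S (qU M s *m psi)) + qweight S (qmove M psi s) w'
  else 0.

Definition qhalt (Sigma : finType) (M : mmqfa Sigma) := qacc M :|: qrej M.

Definition qinit (Sigma : finType) (M : mmqfa Sigma) : 'cV[Cplx]_(qdim M) :=
  delta_mx (qstart M) 0.

Lemma foldl_qstepE (Sigma : finType) (M : mmqfa Sigma) psi pa pr w :
  foldl (@qstep Sigma M) (psi, pa, pr) w
  = (qrun M psi w, pa + qweight (qacc M) psi w, pr + qweight (qrej M) psi w).
Proof.
elim: w psi pa pr => [|s w IH] psi pa pr /=; first by rewrite !addr0.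
by rewrite IH !addrA.
Qed.

Lemma acc_probE (Sigma : finType) (M : mmqfa Sigma) x :
  acc_prob M x = qweight (qacc M) (qinit M) (map Some x ++ [:: None]).
Proof. by rewrite /acc_prob foldl_qstepE /= add0r. Qed.

Lemma qrun_cat (Sigma : finType) (M : mmqfa Sigma) psi v w :
  qrun M psi (v ++ w) = qrun M (qrun M psi v) w.
Proof. exact: foldl_cat. Qed.

Lemma qweight_cat (Sigma : finType) (M : mmqfa Sigma) (S : {set 'I_(qdim M)}) psi v w :
  qweight S psi (v ++ w) = qweight S psi v + qweight S (qrun M psi v) w.
Proof.
by elim: v psi => [|s v IH] psi /=; rewrite ?add0r // IH addrA.
Qed.

Lemma qweight_ge0 (Sigma : finType) (M : mmqfa Sigma) (S : {set 'I_(qdim M)}) psi w :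
  0 <= qweight S psi w.
Proof.
by elim: w psi => //= s w IH psi; rewrite addr_ge0 ?normsq_ge0.
Qed.

Lemma qweight_sub (Sigma : finType) (M : mmqfa Sigma) (S T : {set 'I_(qdim M)}) psi w :
  S \subset T -> qweight S psi w <= qweight T psi w.
Proof.
by move=> ST; elim: w psi => //= s w IH psi; rewrite lerD ?normsq_proj_sub.
Qed.

Lemma qmoveD (Sigma : finType) (M : mmqfa Sigma) a b s :
  qmove M (a + b) s = qmove M a s + qmove M b s.
Proof. by rewrite /qmove mulmxDr projD. Qed.

Lemma qmoveN (Sigma : finType) (M : mmqfa Sigma) a s :
  qmove M (- a) s = - qmove M a s.
Proof. by rewrite /qmove mulmxN projN. Qed.

Lemma qrunB (Sigma : finType) (M : mmqfa Sigma) a b w :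
  qrun M (a - b) w = qrun M a w - qrun M b w.
Proof. by elim: w a b => //= s w IH a b; rewrite qmoveD qmoveN IH. Qed.

Lemma qweightN (Sigma : finType) (M : mmqfa Sigma) (S : {set 'I_(qdim M)}) a w :
  qweight S (- a) w = qweight S a w.
Proof.
by elim: w a => //= s w IH a; rewrite mulmxN projN normsqN qmoveN IH.
Qed.

(** The weight is a sum of squared norms of linear images of the vector, so Peter-Paul applies term
    by term. *)
Lemma qweightD_le (Sigma : finType) (M : mmqfa Sigma) (S : {set 'I_(qdim M)}) t a b w :
  0 < t ->
  qweight S (a + b) w <= (1 + t) * qweight S a w + (1 + t^-1) * qweight S b w.
Proof.
move=> t0; elim: w a b => [|s w IH] a b /=; first by rewrite !mulr0 addr0.
rewrite mulmxDr projD qmoveD.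
have := normsqD_le (proj S (qU M s *m a)) (proj S (qU M s *m b)) t0.
have := IH (qmove M a s) (qmove M b s); lra.
Qed.

Lemma qweightB_le (Sigma : finType) (M : mmqfa Sigma) (S : {set 'I_(qdim M)}) a b w :
  qweight S (a - b) w <= 2 * qweight S a w + 2 * qweight S b w.
Proof. by have := qweightD_le S a (- b) w ltr01; rewrite qweightN invr1. Qed.

(** Conservation: each unitary preserves the norm, which then splits orthogonally into a surviving
    and a halting part. *)
Lemma normsq_qrun (Sigma : finType) (M : mmqfa Sigma) psi w :
  normsq (qrun M psi w) + qweight (qhalt M) psi w = normsq psi.
Proof.
elim: w psi => [|s w IH] psi /=; first by rewrite addr0.
rewrite -(normsq_unitary psi (qU_unitary M s)).
rewrite -(normsq_projC (qhalt M) (qU M s *m psi)).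
by have := IH (qmove M psi s); rewrite /qmove /qnon -/(qhalt M); lra.
Qed.

Lemma qweight_acc_le (Sigma : finType) (M : mmqfa Sigma) psi w :
  qweight (qacc M) psi w <= normsq psi - normsq (qrun M psi w).
Proof.
have := qweight_sub psi w (subsetUl (qacc M) (qrej M)).
by rewrite -/(qhalt M); have := normsq_qrun psi w; lra.
Qed.

Definition qword (Sigma : finType) (M : mmqfa Sigma) (w : seq Sigma) :=
  qrun M (qinit M) (map Some w).

Definition qword_acc (Sigma : finType) (M : mmqfa Sigma) (w : seq Sigma) :=
  qweight (qacc M) (qinit M) (map Some w).

Lemma qword_cat (Sigma : finType) (M : mmqfa Sigma) (v w : seq Sigma) :
  qword M (v ++ w) = qrun M (qword M v) (map Some w).
Proof. by rewrite /qword map_cat qrun_cat. Qed.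

Lemma normsq_qword_cat (Sigma : finType) (M : mmqfa Sigma) (v w : seq Sigma) :
  normsq (qword M (v ++ w)) <= normsq (qword M v).
Proof.
rewrite qword_cat; have := normsq_qrun (qword M v) (map Some w).
by have := qweight_ge0 (qhalt M) (qword M v) (map Some w); lra.
Qed.

Lemma normsq_qword_le1 (Sigma : finType) (M : mmqfa Sigma) (w : seq Sigma) :
  normsq (qword M w) <= 1.
Proof.
by rewrite -(normsq_delta (qstart M)) (normsq_qword_cat M [::] w).
Qed.

Lemma qword_acc_le1 (Sigma : finType) (M : mmqfa Sigma) (w : seq Sigma) :
  qword_acc M w <= 1.
Proof.
rewrite -(normsq_delta (qstart M)).
apply: le_trans (qweight_acc_le _ _) _.
by rewrite lerBlDr lerDl normsq_ge0.
Qed.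

Lemma acc_prob_cat (Sigma : finType) (M : mmqfa Sigma) (v w : seq Sigma) :
  acc_prob M (v ++ w)
  = qword_acc M v + qweight (qacc M) (qword M v) (map Some w ++ [:: None]).
Proof. by rewrite acc_probE map_cat -catA qweight_cat. Qed.

Definition nerode (Sigma : finType) (L : language Sigma) (v w : seq Sigma) :=
  forall z, L (v ++ z) <-> L (w ++ z).

Lemma qword_close_nerode (Sigma : finType) (M : mmqfa Sigma) (L : language Sigma)
    (lambda eps : Real) :
  0 < eps ->
  (forall x, (L x -> lambda + eps < acc_prob M x) /\
             (~ L x -> acc_prob M x < lambda - eps)) ->
  exists2 eta : Real, 0 < eta & forall v w,
    normsq (qword M v - qword M w) <= eta ->
    `|qword_acc M v - qword_acc M w| <= eta -> nerode L v w.
Proof.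
(* With these choices the two acceptance probabilities differ by at most
   [eta + t + (1 + t^-1) * eta = 3/2 * eps], less than the gap [2 * eps]. *)
move=> e0 HL; pose t := eps / 2.
have t0 : 0 < t by rewrite /t; lra.
have ti0 : 0 < t^-1 by rewrite invr_gt0.
pose eta := eps / (2 + t^-1).
have eta0 : 0 < eta by rewrite divr_gt0 // addr_gt0.
have etaE : (2 + t^-1) * eta = eps by rewrite mulrC divfK // gt_eqF // addr_gt0.
exists eta => //.
have half v w z : normsq (qword M v - qword M w) <= eta ->
    `|qword_acc M v - qword_acc M w| <= eta -> L (v ++ z) -> L (w ++ z).
  move=> Hn Ha Lv; apply: contrapT => Lw.
  have := (HL (v ++ z)).1 Lv; have := (HL (w ++ z)).2 Lw.
  rewrite !acc_prob_cat; set z' := _ ++ _.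
  have := qweightD_le (qacc M) (qword M w) (qword M v - qword M w) z' t0.
  rewrite addrC subrK.
  have := qweight_acc_le (qword M w) z'.
  have := qweight_acc_le (qword M v - qword M w) z'.
  have := normsq_ge0 (qrun M (qword M w) z').
  have := normsq_ge0 (qrun M (qword M v - qword M w) z').
  have := normsq_qword_le1 M w.
  move: Ha; rewrite ler_norml => /andP[_ Ha].
  set A := qweight _ (_ - _) _; set B := qweight _ (qword M w) _.
  set C := qweight _ (qword M v) _ => n1 n2 n3 hA hB hC.
  have tA : t^-1 * A <= t^-1 * eta by rewrite ler_pM2l //; lra.
  have tB : t * B <= t * 1 by rewrite ler_pM2l //; lra.
  have : t * 2 = eps by rewrite /t; lra.
  lra.
move=> v w Hn Ha z; split; first exact: half.
by apply: half; [rewrite -opprB normsqN | rewrite distrC].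
Qed.

(** * Finite grids *)

Lemma real_grid (eta : Real) : 0 < eta ->
  exists (K : nat) (c : Real -> 'I_K.+1), forall a b,
    -1 <= a <= 1 -> -1 <= b <= 1 -> c a = c b -> `|a - b| <= eta.
Proof.
move=> e0; pose f (a : Real) := Num.truncn ((a + 1) / eta).
(* [inord] sends indices above [K] to 0; none occurs on [-1, 1], where
   [(a + 1) / eta <= 2 / eta]. *)
pose K := Num.truncn (2 / eta : Real); exists K, (fun a => inord (f a)).
have fle a : -1 <= a <= 1 -> (f a < K.+1)%N.
  move=> /andP[a1 a2]; rewrite ltnS le_truncn // ler_pM2r ?invr_gt0 //; lra.
have fP a : -1 <= a <= 1 -> (f a)%:R * eta <= a + 1 < (f a).+1%:R * eta.
  move=> /andP[a1 a2]; rewrite -ler_pdivlMr // -ltr_pdivrMr //.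
  by apply: truncn_itv; rewrite divr_ge0 ?(ltW e0) //; lra.
move=> a b ha hb /(congr1 val); rewrite /= !inordK ?fle // => fab.
have /andP[] := fP _ ha; have /andP[] := fP _ hb.
rewrite fab -!natr1 ler_norml => *; apply/andP; split; lra.
Qed.

Lemma normsq_grid n (eta : Real) : 0 < eta ->
  exists (C : finType) (c : 'cV[Cplx]_n -> C), forall a b,
    normsq a <= 1 -> normsq b <= 1 -> c a = c b -> normsq (a - b) <= eta.
Proof.
(* The bound [h <= 1] turns [|x| <= h] into [x ^+ 2 <= h], so each of the [n] coordinates costs at
   most [2 * h]; [n.+1] keeps the division sound for [n = 0]. *)
move=> e0; pose h : Real := Num.min 1 (eta / (2 * n.+1%:R)).
have n0 : 0 < n.+1%:R :> Real by rewrite ltr0n.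
have h0 : 0 < h by rewrite lt_min ltr01 divr_gt0 // mulr_gt0.
have h1 : h <= 1 by rewrite ge_min lexx.
have h2 : h <= eta / (2 * n.+1%:R) by rewrite ge_min lexx orbT.
have [K [c cP]] := real_grid h0.
pose g (a : 'cV[Cplx]_n) :=
  [ffun i : 'I_n => (c (complex.Re (a i 0)), c (complex.Im (a i 0)))].
exists {ffun 'I_n -> 'I_K.+1 * 'I_K.+1}, g => a b a1 b1 gab.
have bnd d (i : 'I_n) : normsq d <= 1 ->
    -1 <= complex.Re (d i 0) <= 1 /\ -1 <= complex.Im (d i 0) <= 1.
  move=> d1; have := le_trans (sqmod_le_normsq d i) d1; rewrite /sqmod.
  move: (complex.Re _) (complex.Im _) => x y xy.
  by split; rewrite -ler_norml -(expr_le1 (n := 2)) // real_normK ?num_real //;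
    have := sqr_ge0 x; have := sqr_ge0 y; lra.
have sq_le (x : Real) : `|x| <= h -> x ^+ 2 <= h.
  move=> xh; rewrite -real_normK ?num_real // expr2.
  by apply: le_trans (ler_pM _ _ xh xh) _ => //; rewrite ler_piMl // ltW.
have step (i : 'I_n) : sqmod ((a - b) i 0) <= 2 * h.
  have /ffunP/(_ i) := gab; rewrite !ffunE => -[gR gI].
  have [aR aI] := bnd a i a1; have [bR bI] := bnd b i b1.
  have := sq_le _ (cP _ _ aR bR gR); have := sq_le _ (cP _ _ aI bI gI).
  rewrite !mxE /sqmod; case: (a i 0) (b i 0) => [? ?] [? ?] /=; lra.
apply: le_trans (ler_sum _ (fun i _ => step i)) _.
rewrite sumr_const card_ord -[_ *+ n]mulr_natr.
have E (m : Real) : m != 0 -> eta = 2 * (eta / (2 * m)) * m by move=> m0; field.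
rewrite [leRHS](E _ (lt0r_neq0 n0)).
apply: ler_pM; rewrite ?mulr_ge0 ?ler_nat ?(ltW h0) //.
by rewrite ler_pM2l.
Qed.

(** * Finite index and minimal automata *)

(** Nerode's finiteness, by a finite colouring refining the equivalence: no quotient is formed, and
    colourings of two languages can be paired. *)
Definition finite_index (Sigma : finType) (L : language Sigma) :=
  exists (C : finType) (c : seq Sigma -> C),
    forall v w, c v = c w -> nerode L v w.

Lemma RMM_finite_index (Sigma : finType) (L : language Sigma) :
  RMM L -> finite_index L.
Proof.
move=> [M [lambda [eps [e0 HL]]]].
have [eta eta0 close] := qword_close_nerode e0 HL.
have [C [c cP]] := normsq_grid (qdim M) eta0.
have [K [d dP]] := real_grid eta0.
have acc_bnd w : -1 <= qword_acc M w <= 1.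
  rewrite qword_acc_le1 andbT; apply: le_trans (qweight_ge0 _ _ _).
  by rewrite lerN10.
exists (C * 'I_K.+1)%type, (fun w => (c (qword M w), d (qword_acc M w))).
move=> v w [cvw dvw]; apply: close; last exact: dP.
by apply: cP => //; apply: normsq_qword_le1.
Qed.

Lemma finite_index_and (Sigma : finType) (L1 L2 : language Sigma) :
  finite_index L1 -> finite_index L2 -> finite_index (fun w => L1 w /\ L2 w).
Proof.
move=> [C1 [c1 H1]] [C2 [c2 H2]].
exists (C1 * C2)%type, (fun w => (c1 w, c2 w)) => v w [e1 e2] z.
by have := H1 _ _ e1 z; have := H2 _ _ e2 z; tauto.
Qed.

(** The colouring need not be a right congruence, so a colour acts through a chosen representative
    word. The state reached by [w] may differ from [c w], but its representative stays
    Nerode-equivalent to [w]. *)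
Lemma finite_index_dfa (Sigma : finType) (L : language Sigma)
    (C : finType) (c : seq Sigma -> C) :
  (forall v w, c v = c w -> nerode L v w) ->
  exists2 A : dfa Sigma, recognizes A L & #|dstate A| = #|C|.
Proof.
move=> cP.
have /choice[rep repP] : forall q : C, exists w, (exists v, c v = q) -> c w = q.
  move=> q; have [[v vq]|no] := pselect (exists v, c v = q); first by exists v.
  by exists [::] => /no.
pose A := @DFA Sigma C (fun q a => c (rcons (rep q) a)) (c [::])
  (fun q => `[< L (rep q) >]).
exists A => // w.
suff /(_ [::]) : nerode L (rep (dstar (dstart A) w)) w.
  by rewrite !cats0 /dfa_lang => <-; split; rewrite asboolE.
have repK v : nerode L (rep (c v)) v by apply: cP; apply: repP; exists v.
elim/last_ind: w => [|w a IH] z; first exact: repK.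
rewrite /dstar -cats1 foldl_cat /= -/(dstar _ _).
by apply: iff_trans (repK _ z) _; rewrite -cats1 -!catA; apply: IH.
Qed.

Lemma finite_index_minimal_dfa (Sigma : finType) (L : language Sigma) :
  finite_index L -> exists A : dfa Sigma, minimal_dfa_of A L.
Proof.
move=> [C [c cP]]; have [A0 A0L _] := finite_index_dfa cP.
pose P n := `[< exists2 A : dfa Sigma, recognizes A L & #|dstate A| = n >].
have exP : exists n, P n by exists #|dstate A0|; apply/asboolP; exists A0.
case: (ex_minnP exP) => m /asboolP[A AL <-] min_m; exists A; split=> // A' A'L.
by apply: min_m; apply/asboolP; exists A'.
Qed.

Lemma dstar_cat (Sigma : finType) (A : dfa Sigma) (q : dstate A) v w :
  dstar q (v ++ w) = dstar (dstar q v) w.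
Proof. exact: foldl_cat. Qed.

(** If [q] were unreachable, colouring words by the remaining states would yield a recognizer with
    one state fewer. *)
Lemma minimal_dfa_reachable (Sigma : finType) (A : dfa Sigma) (L : language Sigma) :
  minimal_dfa_of A L -> forall q : dstate A, exists w, dstar (dstart A) w = q.
Proof.
move=> [AL min_A] q; apply: contrapT => unreach.
pose C := {p : dstate A | p != q}.
have wP w : dstar (dstart A) w != q by apply/eqP => wq; apply: unreach; exists w.
pose c w : C := exist (fun p => p != q) _ (wP w).
have cP v w : c v = c w -> nerode L v w.
  move=> /(congr1 val) /= vw z.
  by rewrite !AL /dfa_lang !dstar_cat vw.
have [A' A'L cardA'] := finite_index_dfa cP.
have := min_A _ A'L; rewrite cardA' card_sig leqNgt => /negP; apply.
rewrite [ltnRHS](cardD1 q) add1n ltnS; apply: subset_leq_card.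
by apply/subsetP => p; rewrite !inE andbT.
Qed.

(** * The partial order condition *)

Definition wpow (Sigma : finType) (x : seq Sigma) i := flatten (nseq i x).

Lemma wpowD (Sigma : finType) (x : seq Sigma) i j :
  wpow x (i + j) = wpow x i ++ wpow x j.
Proof. by rewrite /wpow nseqD flatten_cat. Qed.

Lemma wpowS (Sigma : finType) (x : seq Sigma) i : wpow x i.+1 = x ++ wpow x i.
Proof. by []. Qed.

(* [N] plays the role of the surviving norm and [c] of a grid on states. *)
Definition almost_recurrent (Sigma : finType) (L : language Sigma) :=
  exists (N : seq Sigma -> Real) (delta : Real) (C : finType) (c : seq Sigma -> C),
  [/\ 0 < delta, forall w, 0 <= N w, forall v w, N (v ++ w) <= N v
    & forall w x j k, (forall i, N w <= N (w ++ wpow x i) + delta) ->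
      c (w ++ wpow x j) = c (w ++ wpow x (j + k)) ->
      nerode L w (w ++ wpow x k)].

Lemma RMM_almost_recurrent (Sigma : finType) (L : language Sigma) :
  RMM L -> almost_recurrent L.
Proof.
move=> [M [lambda [eps [e0 HL]]]].
have [eta eta0 close] := qword_close_nerode e0 HL.
(* The difference of the two states keeps norm at most [delta] after [x^j] and loses at most
   [2 * delta + 2 * delta] on the way. *)
pose delta := eta / 5; have delta0 : 0 < delta by rewrite divr_gt0.
have [C [c cP]] := normsq_grid (qdim M) delta0.
exists (fun w => normsq (qword M w)), delta, C, (fun w => c (qword M w)).
split=> // [w|v w|w x j k Hi Hc]; first exact: normsq_ge0.
  exact: normsq_qword_cat.
have := cP _ _ (normsq_qword_le1 M _) (normsq_qword_le1 M _) Hc.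
(* [x^j] loses little on [w] and on [w x^k], hence little on their difference. *)
have lossj v : normsq (qword M v) <= normsq (qword M (v ++ wpow x j)) + delta ->
    qweight (qhalt M) (qword M v) (map Some (wpow x j)) <= delta.
  by rewrite qword_cat -(normsq_qrun (qword M v) (map Some (wpow x j))); lra.
have loss1 := lossj _ (Hi j).
have loss2 : qweight (qhalt M) (qword M (w ++ wpow x k)) (map Some (wpow x j)) <= delta.
  apply: lossj; rewrite -catA -wpowD; apply: le_trans (Hi _).
  exact: normsq_qword_cat.
rewrite addnC wpowD catA [qword M (w ++ wpow x j)]qword_cat.
rewrite [qword M (_ ++ wpow x j)]qword_cat -qrunB => Hn.
apply: close.
  rewrite -(normsq_qrun _ (map Some (wpow x j))).
  have := qweightB_le (qhalt M) (qword M w) (qword M (w ++ wpow x k))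
    (map Some (wpow x j)).
  have : delta * 5 = eta by rewrite /delta; lra.
  lra.
(* The accumulated acceptances differ by what is accepted while reading [x^k] after [w], at most the
   norm lost there. *)
rewrite distrC /qword_acc map_cat qweight_cat addrC addKr ger0_norm ?qweight_ge0 //.
apply: le_trans (qweight_acc_le _ _) _.
have := Hi k; rewrite qword_cat -/(qword M w).
have : delta * 5 = eta by rewrite /delta; lra.
lra.
Qed.

(** Neither summand of [N1 + N2] can grow, so a bound on the loss of the sum bounds the loss of
    each. *)
Lemma almost_recurrent_and (Sigma : finType) (L1 L2 : language Sigma) :
  almost_recurrent L1 -> almost_recurrent L2 ->
  almost_recurrent (fun w => L1 w /\ L2 w).
Proof.
move=> [N1 [d1 [C1 [c1 [d1_0 N1_0 N1_le H1]]]]].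
move=> [N2 [d2 [C2 [c2 [d2_0 N2_0 N2_le H2]]]]].
exists (fun w => N1 w + N2 w), (Num.min d1 d2), (C1 * C2)%type,
  (fun w => (c1 w, c2 w)).
have min1 : Num.min d1 d2 <= d1 by rewrite ge_min lexx.
have min2 : Num.min d1 d2 <= d2 by rewrite ge_min lexx orbT.
split=> [|w|v w|w x j k Hi [Hc1 Hc2] z].
- by rewrite lt_min d1_0.
- by rewrite addr_ge0.
- by rewrite lerD.
have HL1 : nerode L1 w (w ++ wpow x k).
  by apply: H1 Hc1 => i; have := Hi i; have := N2_le w (wpow x i); lra.
have HL2 : nerode L2 w (w ++ wpow x k).
  by apply: H2 Hc2 => i; have := Hi i; have := N1_le w (wpow x i); lra.
by have := HL1 z; have := HL2 z; tauto.
Qed.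

Lemma near_minimizer (T : Type) (P : T -> Prop) (f : T -> Real) (delta : Real) x0 :
  0 < delta -> (forall x, 0 <= f x) -> P x0 ->
  exists2 x, P x & forall y, P y -> f x <= f y + delta.
Proof.
move=> d0 f0 Px0.
pose E : classical_sets.set Real := fun r => exists2 x, P x & f x = r.
have infE : classical_sets.has_inf E.
  split; first by exists (f x0), x0.
  by exists 0 => r [x _ <-].
have [r [x Px <-] fx] := inf_adherent d0 infE.
exists x => // y Py; apply: le_trans (ltW fx) _.
by rewrite lerD2r; apply: ge_inf; [apply: infE.2 | exists y].
Qed.

Lemma almost_recurrent_poc (Sigma : finType) (L : language Sigma) (A : dfa Sigma) :
  almost_recurrent L -> minimal_dfa_of A L -> dfa_poc A.
Proof.
move=> [N [delta [C [c [d0 N0 N_le Hrec]]]]] minA.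
move=> [q1 [q2 [x [y [[[z /negP dz] _ _] [q1x q2x q2y]]]]]].
have [u uq1] := minimal_dfa_reachable minA q1.
have [w wq1 wmin] := near_minimizer (P := fun w => dstar (dstart A) w = q1) d0 N0 uq1.
have q2pow i : dstar q2 (wpow x i) = q2.
  by elim: i => // i IH; rewrite wpowS dstar_cat q2x.
have wpowq2 i : dstar (dstart A) (w ++ wpow x i.+1) = q2.
  by rewrite dstar_cat wq1 wpowS dstar_cat q1x.
have Hi i : N w <= N (w ++ wpow x i) + delta.
  (* For a positive power, appending [y] leads back to [q1], where [w] is nearly minimal, and [y]
     cannot raise [N]. *)
  case: i => [|i]; first by rewrite cats0 lerDl ltW.
  apply: le_trans (wmin ((w ++ wpow x i.+1) ++ y) _) _.
    by rewrite dstar_cat wpowq2.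
  by rewrite lerD2r.
(* Pigeonhole on [#|C| + 1] exponents. The period must be positive so that [w x^(k+1)] reaches [q2],
   making [q1] and [q2] agree on [z]. *)
have [j [k Hc]] : exists j k, c (w ++ wpow x j) = c (w ++ wpow x (j + k.+1)).
  pose g (i : 'I_#|C|.+1) := c (w ++ wpow x i).
  have /injectivePn[i1 [i2 ne gi]] : ~~ injectiveb g.
    by apply/negP => /injectiveP/leq_card; rewrite card_ord ltnn.
  wlog lt12 : i1 i2 ne gi / (i1 < i2)%N.
    move=> W; case: (ltngtP i1 i2) => [|/(W i2 i1)|/val_inj e].
    - exact: W.
    - by apply => //; rewrite eq_sym.
    - by rewrite e eqxx in ne.
  by exists i1, (i2 - i1).-1; rewrite prednK ?subn_gt0 // subnKC // ltnW.
have := Hrec w x j k.+1 Hi Hc z; have [AL _] := minA.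
rewrite !AL /dfa_lang (dstar_cat _ w) (dstar_cat _ (w ++ _)) wq1 wpowq2.
by move=> e; apply: dz; apply/eqP; apply/idP/idP => /e.
Qed.

Theorem theorem4p6 :
  (forall (Sigma : finType) (L : language Sigma), lang_poc L -> RMM L) ->
  forall (Sigma : finType) (L1 L2 : language Sigma),
    RMM L1 -> RMM L2 -> RMM (fun w => L1 w /\ L2 w).
Proof.
move=> poc_RMM Sigma L1 L2 R1 R2; apply: poc_RMM.
(* [lang_poc] demands a minimal automaton, which exists because the intersection has finite
   index. *)
have [A minA] := finite_index_minimal_dfa
  (finite_index_and (RMM_finite_index R1) (RMM_finite_index R2)).
exists A; split=> //; apply: almost_recurrent_poc minA.
by apply: almost_recurrent_and; apply: RMM_almost_recurrent.
Qed.
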